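(* For each $N\in\mathbb{N}$ let $\theta_k=\theta_k^{(N)}\in\mathbb{C}$, $1\le k\le N$, be given, and put $$f_k(z):=\frac{\rho_k z}{1-z},\qquad \rho_k=e^{2\pi i\theta_k}.$$ Suppose $\{\theta_k\}$ satisfies any one of the following: (1) $\theta_k=\frac1N+O\left(\frac1{N^3}\right)$; (2) $\theta_k=\frac1N+\frac{c_k}{N^2}$ with $c_k\in\mathbb{C}$ uniformly bounded and $c_k+c_{k+1}=O\left(\frac1N\right)$ for odd $k$; (3) $\theta_k=\frac1N+\frac{Ce^{2\pi i k/N}}{N^2}$, where $C$ is any constant in $\mathbb{C}$. Then $f_N\circ f_{N-1}\circ\cdots\circ f_1\to\mathrm{Id}$ as $N\to\infty$, uniformly on compact subsets of $\mathbb{C}$.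
   Context: The quantities $\theta_k,c_k$ (hence $\rho_k$ and $f_k$) may depend on $N$ as well as on $k$; the constant $C$ in (3) does not. ''Uniformly bounded'' and the $O(\cdot)$ terms are uniform in $k$ and $N$. The $f_k$ are regarded as Möbius transformations of the Riemann sphere, so that compositions are always defined. *)

(* Defs.v *)
From HB Require Import structures.
From mathcomp Require Import all_boot all_order all_algebra.
From mathcomp Require Import all_classical all_reals all_analysis.
From mathcomp Require Import complex.

Set Implicit Arguments.
Unset Strict Implicit.
Unset Printing Implicit Defensive.

Import Order.TTheory GRing.Theory Num.Theory.
Import numFieldNormedType.Exports.

Local Open Scope classical_set_scope.
Local Open Scope ring_scope.
Local Open Scope complex_scope.

Definition cexp (R : realType) (z : R[i]) : R[i] :=
  (expR (complex.Re z))%:C * (cos (complex.Im z) +i* sin (complex.Im z)).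

(* [None] is the point at infinity. *)
Definition sphere (R : realType) : Type := option R[i].

(* z |-> (a z + b) / (c z + d) on the sphere; meant for a d - b c != 0. *)
Definition mobius (R : realType) (a b c d : R[i]) (x : sphere R) : sphere R :=
  match x with
  | Some z => if c * z + d == 0 then None else Some ((a * z + b) / (c * z + d))
  | None => if c == 0 then None else Some (a / c)
  end.

Definition rho (R : realType) (theta : R[i]) : R[i] :=
  cexp (2%:R * pi%:C * 'i%C * theta).

Definition f (R : realType) (theta : R[i]) : sphere R -> sphere R :=
  mobius (rho theta) 0 (-1) 1.

(* f_n o f_(n-1) o ... o f_1 *)
Fixpoint fcomp (R : realType) (theta : nat -> R[i]) (n : nat) :
    sphere R -> sphere R :=
  if n is m.+1 then f (theta m.+1) \o fcomp theta m else id.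

(* In the conditions below [theta N k] and [c N k] are theta_k^(N) and c_k^(N);
   only their values at 1 <= k <= N matter. *)

Definition condition1 (R : realType) (theta : nat -> nat -> R[i]) : Prop :=
  exists M : R, forall N k : nat, (1 <= k <= N)%N ->
    `|theta N k - 1 / N%:R| <= M%:C * (1 / N%:R ^+ 3).

(* For N odd and k = N there is no c_(k+1), hence the restriction k < N. *)
Definition condition2 (R : realType) (theta : nat -> nat -> R[i]) : Prop :=
  exists c : nat -> nat -> R[i],
    [/\ forall N k : nat, (1 <= k <= N)%N ->
          theta N k = 1 / N%:R + c N k / N%:R ^+ 2,
        exists B : R, forall N k : nat, (1 <= k <= N)%N -> `|c N k| <= B%:C
      & exists M : R, forall N k : nat, (1 <= k < N)%N -> odd k ->
          `|c N k + c N k.+1| <= M%:C * (1 / N%:R)].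

Definition condition3 (R : realType) (theta : nat -> nat -> R[i]) : Prop :=
  exists C : R[i], forall N k : nat, (1 <= k <= N)%N ->
    theta N k =
      1 / N%:R + C * cexp (2%:R * pi%:C * 'i%C * k%:R / N%:R) / N%:R ^+ 2.

(* Locally uniform convergence on C, to the inclusion of C in the sphere, of
   maps into the sphere. The limit being bounded on a compact set, this is the
   same for the chordal metric and for the modulus; the latter requires the
   values to be eventually finite. The regular algebra R[i]^o carries the
   topology of the modulus. *)
Definition cvg_id_compactly (R : realType)
    (F : nat -> sphere R -> sphere R) : Prop :=
  forall K : set R[i]^o, compact K ->
  forall eps : R, 0 < eps ->
  \forall N \near \oo, forall z : R[i], K z ->
    exists2 w : R[i], F N (Some z) = Some w & `|w - z| < eps%:C.

(* Main.v *)
Require Import Defs.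
From HB Require Import structures.
From mathcomp Require Import all_boot all_order all_algebra.
From mathcomp Require Import all_classical all_reals all_analysis.
From mathcomp Require Import complex.
From mathcomp Require Import ring lra.

(** In matrix form the composition of [f_1, ..., f_n] is lower triangular:
    it is [z |-> P_n z / (1 - T_n z)] with [P_j = rho_1 ... rho_j] and
    [T_n = P_0 + ... + P_(n-1)], so it suffices that [P_N -> 1] and
    [T_N -> 0]. Writing [w = exp (2 pi i / N)] and letting [E_j] be the sum of
    [theta_k - 1 / N] over [k <= j], we have [P_j = w^j exp (2 pi i E_j)].
    Since the powers [w^j], [j < N], sum to [0], a second order expansion of
    the exponential gives [T_N = 2 pi i (sum_j w^j E_j) + O(N max_j |E_j|^2)].
    Under (1) and (2) one has [E_j = O(1 / N^2)], by pairing consecutive terms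
    in case (2). Under (3) the trivial bound [E_j = O(1 / N)] controls the
    remainder, and the linear term vanishes because [w] and [w^2] are both
    nontrivial [N]-th roots of unity for [N > 2]. *)

Import Order.TTheory GRing.Theory Num.Theory.
Import numFieldNormedType.Exports.
Import Normc.

Local Open Scope ring_scope.
Local Open Scope complex_scope.

(** * The real-valued modulus on [R[i]] *)

Section ComplexModulus.
Context {R : realType}.
Implicit Types (x y z : R[i]).

Lemma normrE_normc z : `|z| = (normc z)%:C. Proof. by []. Qed.

Lemma normc_ge0 z : 0 <= normc z.
Proof. by rewrite -lecR; exact: (@normr_ge0 _ R[i]). Qed.

Lemma ler_normcD x y : normc (x + y) <= normc x + normc y.
Proof. by rewrite -lecR rmorphD; exact: (@ler_normD _ R[i]). Qed.

Lemma normc_opp z : normc (- z) = normc z.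
Proof. exact: normcN. Qed.

Lemma ler_normcB x y : normc (x - y) <= normc x + normc y.
Proof. by rewrite -[normc y]normc_opp ler_normcD. Qed.

Lemma normcX z n : normc (z ^+ n) = normc z ^+ n.
Proof. by elim: n => [|n IH]; rewrite ?normc1 // !exprS normcM IH. Qed.

Lemma normc_real (a : R) : normc a%:C = `|a|.
Proof. by rewrite /= expr0n addr0 sqrtr_sqr. Qed.

Lemma normc_nat n : normc (n%:R : R[i]) = n%:R.
Proof. by rewrite -(rmorph_nat (real_complex R)) normc_real normr_nat. Qed.

Lemma normc_i : normc ('i : R[i]) = 1.
Proof. by rewrite /= expr0n add0r expr1n sqrtr1. Qed.

Lemma ler_normc_sum n (F : 'I_n -> R[i]) :
  normc (\sum_i F i) <= \sum_i normc (F i).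
Proof.
elim/big_ind2: _ => [|x1 x2 y1 y2 h1 h2|//]; first by rewrite normc0.
by rewrite (le_trans (ler_normcD _ _))// lerD.
Qed.

Lemma ler_normc_sumc n (F : 'I_n -> R[i]) (b : R) :
  (forall i, normc (F i) <= b) -> normc (\sum_i F i) <= n%:R * b.
Proof.
move=> Fb; rewrite (le_trans (ler_normc_sum _ _))//.
rewrite (le_trans (ler_sum _ (fun i _ => Fb i)))//.
by rewrite sumr_const card_ord mulr_natl.
Qed.

Lemma ler_normc_Re_Im z : normc z <= `|complex.Re z| + `|complex.Im z|.
Proof.
rewrite [z in normc z]complexE (le_trans (ler_normcD _ _))//.
by rewrite normcM normc_i mul1r !normc_real.
Qed.

Lemma ler_Re_normc z : `|complex.Re z| <= normc z.
Proof. by rewrite -lecR; exact: normc_ge_Re. Qed.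

Lemma ler_Im_normc z : `|complex.Im z| <= normc z.
Proof.
by rewrite -normrN -ReiNIm (le_trans (ler_Re_normc _))// normcM normc_i mulr1.
Qed.

(** Consecutive terms are grouped in pairs, each costing [m]; an odd [j] leaves one unpaired last
    term, which costs [B]. Indices start at 0 here, so pairs begin at even [k]. *)
Lemma ler_normc_sum_pairs (c : nat -> R[i]) (B m : R) (n : nat) :
  0 <= m ->
  (forall k, (k < n)%N -> normc (c k) <= B) ->
  (forall k, (k.+1 < n)%N -> ~~ odd k -> normc (c k + c k.+1) <= m) ->
  forall j, (j <= n)%N -> normc (\sum_(k < j) c k) <= n%:R * m + (odd j)%:R * B.
Proof.
move=> m0 cB cm.
have even_case i : (i.*2 <= n)%N -> normc (\sum_(k < i.*2) c k) <= i%:R * m.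
  elim: i => [|i IH] in_; first by rewrite big_ord0 normc0 mul0r.
  rewrite doubleS 2!big_ord_recr/= -addrA (le_trans (ler_normcD _ _))//.
  rewrite -natr1 mulrDl mul1r lerD ?IH ?cm ?odd_double//.
  by rewrite (leq_trans _ in_)// doubleS ltnW.
move=> j jn; have jE := odd_double_half j.
have dn : (j./2.*2 <= n)%N by rewrite (leq_trans _ jn)// -[leqRHS]jE leq_addl.
have le_nm : j./2%:R * m <= n%:R * m.
  by rewrite ler_wpM2r// ler_nat (leq_trans _ dn)// -addnn leq_addr.
have -> : \sum_(k < j) c k = \sum_(k < j./2.*2 + odd j) c k.
  by rewrite addnC jE.
case: (boolP (odd j)) jE => oj jE.
  rewrite addn1 big_ord_recr/= mul1r (le_trans (ler_normcD _ _))// lerD//.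
    by rewrite (le_trans (even_case _ _)).
  by rewrite cB// (leq_trans _ jn)// -[leqRHS]jE.
by rewrite addn0 mul0r addr0 (le_trans (even_case _ _)).
Qed.

(** Compactness is used in near-covering form along [n] tending to infinity: on the unit ball around
    [z] the modulus is at most [n] once [n >= |z| + 1], so a single [n] serves all of [K]. *)
Lemma compact_normc_bounded (K : set R[i]^o) :
  compact K -> exists b : R, forall z, K z -> normc z <= b.
Proof.
move/compact_near_coveringP => /(_ _ \oo%classic (fun n z => normc z <= n%:R)) H.
have [|n _ /(_ n (leqnn n)) Kn] := H _; last by exists n%:R => z /Kn.
move=> z _; exists (ball z 1, [set n | normc z + 1 <= n%:R]%classic);
  first split => /=.
- exact: nbhsx_ballx.
- exact: nbhs_infty_ger.
- move=> [y n]/= [].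
  rewrite -ball_normE/= normrE_normc -(rmorph1 (real_complex R)) ltcR => zy zn.
  have := ler_normcB z (z - y); rewrite opprB addrC subrK; lra.
Qed.

End ComplexModulus.

(** * Second-order bounds for the real exponential, sine and cosine *)

Section RealBounds.
Context {R : realType}.
Implicit Types a b : R.

(** The inequality [1 + x <= expR x] at [a] and [- a] gives [1 + a <= expR a <= 1 / (1 - a)], and
    [1 / (1 - a) - 1 - a = a ^+ 2 / (1 - a)] with [1 - a >= 1 / 2]. *)
Lemma ler_expR_sub1 a : `|a| <= 2^-1 -> `|expR a - 1 - a| <= 2 * a ^+ 2.
Proof.
move=> ha; have := expR_ge1Dx a; have := expR_ge1Dx (- a); rewrite expRN => h1 h2.
have {ha}[ha ha'] : - 2^-1 <= a /\ a <= 2^-1 by apply/andP; rewrite -ler_norml.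
have e0 := expR_gt0 a.
have h3 : (1 - a) * expR a <= 1 by rewrite -ler_pdivlMr// div1r.
rewrite ger0_norm; last lra.
nra.
Qed.

(** Locating the intermediate point only by [|c| <= |b|] treats both signs of [b] at once, and lets
    each bound below feed on the previous one through the derivative. *)
Lemma MVT_from0 (g dg : R -> R) b :
  (forall x : R, is_derive x 1 g (dg x)) ->
  exists2 c, `|c| <= `|b| & g b - g 0 = dg c * b.
Proof.
move=> gd; have gc x : {for x, continuous g}.
  by apply/differentiable_continuous/derivable1_diffP; have [] := gd x.
have gw (A : set R) : {within A, continuous g}%classic.
  by apply: continuous_subspaceT => x; exact: gc.
have [b0|b0] := leP 0 b.
- have [c cb ->] := MVT_segment b0 (fun x _ => gd x) (gw _).
  move: cb; rewrite in_itv/= => /andP[c0 cb]; exists c; rewrite ?subr0//.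
  by rewrite !ger0_norm.
- have [c cb] := MVT_segment (ltW b0) (fun x _ => gd x) (gw _).
  move: cb; rewrite in_itv/= => /andP[c0 cb]; rewrite sub0r => e; exists c.
    by rewrite !ler0_norm ?lerN2 // ltW.
  by rewrite -opprB e mulrN opprK.
Qed.

Lemma ler_sin_norm b : `|sin b| <= `|b|.
Proof.
have [c _] := MVT_from0 sin cos b (@is_derive_sin R).
by rewrite sin0 subr0 => ->; rewrite normrM ler_piMl ?cos_max.
Qed.

Lemma ler_cos_sub1 b : `|cos b - 1| <= b ^+ 2.
Proof.
have [c cb] := MVT_from0 cos (fun x => - sin x) b (@is_derive_cos R).
rewrite cos0 => ->; rewrite normrM normrN -real_normK ?num_real// expr2.
by rewrite ler_wpM2r// (le_trans (ler_sin_norm _)).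
Qed.

Lemma ler_sin_subid b : `|b| <= 1 -> `|sin b - b| <= b ^+ 2.
Proof.
move=> b1.
have [c cb] := MVT_from0 sin cos b (@is_derive_sin R).
rewrite sin0 subr0 => ->; rewrite -{2}[b]mul1r -mulrBl normrM -real_normK ?num_real// expr2.
rewrite ler_wpM2r// (le_trans (ler_cos_sub1 _))// -real_normK ?num_real//.
by rewrite (le_trans _ cb)// expr2 ler_piMr// (le_trans cb).
Qed.

End RealBounds.

(** * The complex exponential and the multipliers [rho] *)

Section Exponential.
Context {R : realType}.
Implicit Types (x y z : R[i]).

Lemma cexpD x y : cexp (x + y) = cexp x * cexp y.
Proof.
case: x => a b; case: y => c d; rewrite /cexp /= expRD cosD sinD.
by apply/eqP; rewrite eq_complex /=; apply/andP; split; apply/eqP; ring.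
Qed.

Lemma cexp0 : cexp (0 : R[i]) = 1.
Proof. by rewrite /cexp /= expR0 cos0 sin0 mul1r. Qed.

(** Real and imaginary parts are split so that each summand contains one of the small quantities
    [expR a - 1 - a], [cos b - 1], [a * sin b], [sin b - b], all of second order. *)
Lemma ler_cexp_sub1 z :
  normc z <= 2^-1 -> normc (cexp z - 1 - z) <= 8 * normc z ^+ 2.
Proof.
move=> z1; have := ler_Re_normc z; have := ler_Im_normc z.
move=> br ar; apply: le_trans (ler_normc_Re_Im _) _.
move: (normc z) z1 br ar => r r1; case: z => a b; rewrite /cexp /= => br ar.
have aE : `|a| ^+ 2 = a ^+ 2 by rewrite real_normK ?num_real.
have bE : `|b| ^+ 2 = b ^+ 2 by rewrite real_normK ?num_real.
have ha := normr_ge0 a; have hb := normr_ge0 b.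
have he : `|expR a - 1 - a| <= 2 * a ^+ 2.
  by apply: ler_expR_sub1; rewrite (le_trans ar).
have hc := ler_cos_sub1 b; have hs := ler_sin_norm b.
have hsb : `|sin b - b| <= b ^+ 2 by apply: ler_sin_subid; lra.
have hcm := cos_max b.
have -> : expR a * cos b - 0 * sin b - 1 - a =
  (expR a - 1 - a) * cos b + (1 + a) * (cos b - 1) by ring.
have -> : expR a * sin b + 0 * cos b - 0 - b =
  (expR a - 1 - a) * sin b + (a * sin b + (sin b - b)) by ring.
have h1 : `|(expR a - 1 - a) * cos b + (1 + a) * (cos b - 1)| <=
    2 * a ^+ 2 + 3 / 2 * b ^+ 2.
  rewrite (le_trans (ler_normD _ _))// lerD// normrM.
    by rewrite -[leRHS]mulr1 ler_pM.
  by rewrite ler_pM// (le_trans (ler_normD _ _))// normr1; lra.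
have h2 : `|(expR a - 1 - a) * sin b + (a * sin b + (sin b - b))| <=
    2 * a ^+ 2 * 1 + (`|a| * `|b| + b ^+ 2).
  rewrite (le_trans (ler_normD _ _))// lerD//; first by rewrite normrM ler_pM ?sin_max.
  by rewrite (le_trans (ler_normD _ _))// lerD// normrM ler_wpM2l.
(* As [|a|] and [|b|] are at most [r], the two bounds add up to at most [15 / 2 * r ^+ 2]. *)
nra.
Qed.

Lemma rhoD x y : rho (x + y) = rho x * rho y.
Proof. by rewrite /rho mulrDr cexpD. Qed.

Lemma rho0 : rho (0 : R[i]) = 1.
Proof. by rewrite /rho mulr0 cexp0. Qed.

Lemma rho_neq0 x : rho x != 0.
Proof.
apply/eqP => x0; have := rhoD x (- x); rewrite subrr rho0 x0 mul0r.
by move/eqP; rewrite oner_eq0.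
Qed.

Lemma rhoMn x n : rho (x *+ n) = rho x ^+ n.
Proof. by elim: n => [|n IH]; rewrite ?mulr0n ?rho0// mulrS rhoD IH exprS. Qed.

Lemma rho_sum n (F : nat -> R[i]) :
  rho (\sum_(k < n) F k) = \prod_(k < n) rho (F k).
Proof.
by elim: n => [|n IH]; rewrite ?big_ord0 ?rho0// !big_ord_recr/= rhoD IH.
Qed.

Lemma rho_real (t : R) : rho t%:C = cos (2 * pi * t) +i* sin (2 * pi * t).
Proof.
have -> : rho t%:C = cexp (0 +i* (2 * pi * t)).
  rewrite /rho -(rmorph_nat (real_complex R)) -rmorphM mulrAC -rmorphM.
  by congr cexp; simpc.
by rewrite /cexp /= expR0 mul1r.
Qed.

Lemma normc_rho_real (t : R) : normc (rho t%:C) = 1.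
Proof. by rewrite rho_real /= cos2Dsin2 sqrtr1. Qed.

End Exponential.

(** * Roots of unity and sums of their powers *)

Lemma sum_powers_eq0 (F : fieldType) (x : F) n :
  x != 1 -> x ^+ n = 1 -> \sum_(i < n) x ^+ i = 0.
Proof.
move=> x1 xn; apply/eqP; have := subrX1 x n; rewrite xn subrr => /esym/eqP.
by rewrite mulf_eq0 subr_eq0 (negbTE x1).
Qed.

(** Multiplying by [x - 1] telescopes the inner geometric sum and turns the [j]-th term into
    [x * (x ^+ 2) ^+ j - x * x ^+ j]; both [x] and [x ^+ 2] are nontrivial [n]-th roots of unity, so
    both resulting sums vanish. *)
Lemma sum_powers_partial_sums_eq0 (F : fieldType) (x : F) n :
  x != 1 -> x ^+ 2 != 1 -> x ^+ n = 1 ->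
  \sum_(j < n) x ^+ j * \sum_(k < j) x ^+ k.+1 = 0.
Proof.
move=> x1 x2 xn; have x10 : x - 1 != 0 by rewrite subr_eq0.
apply: (mulfI x10); rewrite mulr0 mulr_sumr.
rewrite (eq_bigr (fun j : 'I_n => x * (x ^+ 2) ^+ j - x * x ^+ j)) => [|j _].
  rewrite sumrB -!mulr_sumr !sum_powers_eq0 ?mulr0 ?subr0//.
  by rewrite -exprM mulnC exprM xn expr1n.
have -> : \sum_(k < j) x ^+ k.+1 = x * \sum_(k < j) x ^+ k.
  by rewrite mulr_sumr; apply: eq_bigr => k _; rewrite exprS.
by rewrite mulrCA [_ * (x * _)]mulrCA -subrX1 -exprM mulnC exprM; ring.
Qed.

Section RootOfUnity.
Context {R : realType}.
Variable N : nat.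

Definition unity_root : R[i] := rho (1 / N%:R).

Let invN : 1 / N%:R = (N%:R^-1)%:C :> R[i].
Proof. by rewrite div1r fmorphV rmorph_nat. Qed.

Lemma normc_unity_root j : normc (unity_root ^+ j) = 1.
Proof. by rewrite normcX /unity_root invN normc_rho_real expr1n. Qed.

Lemma unity_rootXN : (0 < N)%N -> unity_root ^+ N = 1.
Proof.
move=> N0; rewrite /unity_root -rhoMn -[_ *+ N]mulr_natr div1r mulVf ?pnatr_eq0 -?lt0n//.
rewrite -(rmorph1 (real_complex R)) rho_real mulr1.
by rewrite mulr_natl cos2pi sin2pi.
Qed.

(** The square roots of 1 are real, whereas the imaginary part [sin (2 * pi / N)] is positive
    because [2 * pi / N] lies strictly between 0 and [pi]. *)
Lemma unity_root_sqr_neq1 : (2 < N)%N -> unity_root ^+ 2 != 1.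
Proof.
move=> N2; have : 0 < sin (2 * pi * N%:R^-1 : R).
  have N3 : 3 <= N%:R :> R by rewrite ler_nat.
  have pi0 := pi_gt0 R.
  apply: sin_gt0_pi; apply/andP; split; first by rewrite divr_gt0 ?mulr_gt0//; lra.
  by rewrite ltr_pdivrMr; nra.
rewrite /unity_root invN rho_real => s0; rewrite sqrf_eq1 negb_or.
by rewrite !eq_complex /= oppr0 (gt_eqF s0) !andbF.
Qed.

Lemma unity_root_neq1 : (2 < N)%N -> unity_root != 1.
Proof. by move/unity_root_sqr_neq1; apply: contra => /eqP ->; rewrite expr1n. Qed.

End RootOfUnity.

(** * The composition as a single Möbius map *)

Section Composition.
Context {R : realType}.
Implicit Types (theta : nat -> R[i]) (z P T : R[i]).

(** This is [P_n] of the overview, and [rho_prod_sum] is [T_n]. *)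
Definition rho_prod theta n := \prod_(k < n) rho (theta k.+1).

Definition rho_prod_sum theta n := \sum_(j < n) rho_prod theta j.

Lemma fcompE theta n z :
  fcomp theta n (Some z) =
  mobius (rho_prod theta n) 0 (- rho_prod_sum theta n) 1 (Some z).
Proof.
elim: n => [|n /= ->].
  rewrite /= /rho_prod /rho_prod_sum !big_ord0 oppr0 mul0r add0r oner_eq0.
  by rewrite mul1r addr0 divr1.
have P0 : rho_prod theta n != 0 by apply/prodf_neq0 => k _; exact: rho_neq0.
rewrite /f; have r0 := rho_neq0 (theta n.+1).
have -> : rho_prod theta n.+1 = rho_prod theta n * rho (theta n.+1).
  by rewrite /rho_prod big_ord_recr.
have -> : rho_prod_sum theta n.+1 = rho_prod_sum theta n + rho_prod theta n.
  by rewrite /rho_prod_sum big_ord_recr.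
move: (rho_prod theta n) (rho_prod_sum theta n) (rho _) P0 r0 => P T r P0 r0.
(* If the [n]-th value is infinity, then [T * z = 1], so [z] is nonzero and the next denominator is
   [- (P * z)], also nonzero: the orbit returns to the finite point [- r]. *)
rewrite /mobius; have [Tz|Tz] := eqVneq (- T * z + 1) 0.
  have z0 : z != 0 by apply: contraPneq Tz => ->; rewrite mulr0 add0r; exact/eqP/oner_neq0.
  have -> : - (T + P) * z + 1 = - (P * z) by rewrite -[RHS]add0r -Tz; ring.
  rewrite !oppr_eq0 oner_eq0 mulf_eq0 (negbTE P0) (negbTE z0) /=; congr Some.
  by field; rewrite P0 z0.
have -> : -1 * ((P * z + 0) / (- T * z + 1)) + 1 =
    (- (T + P) * z + 1) / (- T * z + 1) by field.
rewrite mulf_eq0 invr_eq0 (negbTE Tz) orbF.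
case: eqVneq => // TPz; congr Some.
by field; rewrite Tz TPz.
Qed.

(** The condition [d * b <= 1 / 2] keeps the denominator [1 - T * z] at modulus at least [1 / 2];
    this makes the value finite and accounts for the factor 2. *)
Lemma mobius_near_id P T z (d b : R) :
  normc (P - 1) <= d -> normc T <= d -> normc z <= b -> d * b <= 2^-1 ->
  exists2 w, mobius P 0 (- T) 1 (Some z) = Some w &
    normc (w - z) <= 2 * d * (b + b ^+ 2).
Proof.
move=> Pd Td zb db.
have d0 : 0 <= d := le_trans (normc_ge0 _) Td.
have b0 : 0 <= b := le_trans (normc_ge0 _) zb.
have Tz : normc (T * z) <= 2^-1.
  by rewrite normcM (le_trans _ db)// ler_pM ?normc_ge0.
have den : 2^-1 <= normc (- T * z + 1).
  have := ler_normcD (- T * z + 1) (T * z).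
  by rewrite mulNr addrAC addNr add0r normc1; lra.
have den0 : - T * z + 1 != 0.
  by apply: contraTneq den => ->; rewrite normc0 -ltNge invr_gt0.
rewrite /= (negbTE den0); eexists; first by [].
have -> : (P * z + 0) / (- T * z + 1) - z =
  ((P - 1) * z + T * z ^+ 2) / (- T * z + 1) by field.
rewrite normcM normcV ler_pdivrMr; last by rewrite (lt_le_trans _ den)// invr_gt0.
have num : normc ((P - 1) * z + T * z ^+ 2) <= d * (b + b ^+ 2).
  rewrite (le_trans (ler_normcD _ _))// mulrDr (normcM (P - 1)) (normcM T) normcX lerD//.
    by rewrite ler_pM ?normc_ge0.
  by rewrite ler_pM ?normc_ge0 ?exprn_ge0 ?normc_ge0// lerXn2r ?nnegrE ?normc_ge0.
have := normc_ge0 ((P - 1) * z + T * z ^+ 2).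
nra.
Qed.

End Composition.

(** * Reduction to estimates on the accumulated phase error *)

Section Perturbation.
Context {R : realType}.
Variable theta : nat -> nat -> R[i].

(** This is [E_j] of the overview. *)
Definition phase_error N j := \sum_(k < j) (theta N k.+1 - 1 / N%:R).

Lemma rho_prodE N j :
  rho_prod (theta N) j = unity_root N ^+ j * rho (phase_error N j).
Proof.
rewrite /phase_error (rho_sum j (fun k => theta N k.+1 - 1 / N%:R)) /rho_prod.
rewrite -[j in unity_root N ^+ j]card_ord -prodr_const -big_split /=.
by apply: eq_bigr => k _; rewrite /unity_root -rhoD addrC subrK.
Qed.

(** The first hypothesis handles [P_N] and makes the [N] quadratic remainders sum to [O(1 / N)]. By
    itself it would bound the linear part of [T_N] only by a constant, hence the second
    hypothesis. *)
Lemma cvg_id_of_phase_error (D : R) :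
  (forall N j, (0 < N)%N -> (j <= N)%N ->
     normc (phase_error N j) <= D / N%:R) ->
  (forall N, (2 < N)%N ->
     normc (\sum_(j < N) unity_root N ^+ j * phase_error N j) <= D / N%:R) ->
  cvg_id_compactly (fun N => fcomp (theta N) N).
Proof.
move=> phD sumD K /compact_normc_bounded[b0 Kb0] eps eps0.
have D0 : 0 <= D.
  by have := le_trans (normc_ge0 _) (phD 1%N 0%N isT isT); rewrite divr1.
(* [B / N] bounds each exponent [e j]; [A / N] bounds both [P_N - 1] and [T_N], with [B] for the
   linear part and [8 * B ^+ 2] for the remainders. *)
pose b := `|b0|; pose B := 2 * pi * D; pose A := B + 8 * B ^+ 2.
have Kb z : K z -> normc z <= b by move/Kb0/le_trans; apply; exact: ler_norm.
have b_ge0 : 0 <= b by exact: normr_ge0.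
have pi0 := pi_ge0 R.
have B0 : 0 <= B by rewrite !mulr_ge0.
have A0 : 0 <= A by rewrite addr_ge0 ?mulr_ge0 ?exprn_ge0.
(* The summands ensure in turn [N > 2], [B / N <= 1 / 2], [A / N * b <= 1 / 2], and a final error
   below [eps]. *)
pose L := 3 + 2 * B + 2 * A * b + 3 * A * (b + b ^+ 2) / eps.
have := nbhs_infty_ger L; apply: filterS => N LN z Kz.
have h1 : 0 <= 2 * A * b by rewrite !mulr_ge0.
have h2 : 0 <= 3 * A * (b + b ^+ 2) / eps.
  by rewrite divr_ge0 ?(ltW eps0)// !mulr_ge0// addr_ge0// exprn_ge0.
have N2 : (2 < N)%N by rewrite -(ltr_nat R); rewrite /L in LN; lra.
have N0 : (0 < N)%N by exact: ltn_trans N2.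
have NR : 0 < N%:R :> R by rewrite ltr0n.
have BN : B / N%:R <= 2^-1 by rewrite ler_pdivrMr//; rewrite /L in LN; lra.
pose u := 2%:R * pi%:C * 'i%C : R[i].
have uE x : normc (u * x) = 2 * pi * normc x.
  by rewrite /u !normcM normc_nat normc_real normc_i mulr1 ger0_norm.
pose e j := u * phase_error N j.
have eB j : (j <= N)%N -> normc (e j) <= B / N%:R.
  by move=> jN; rewrite uE /B -[leRHS]mulrA ler_wpM2l ?mulr_ge0 ?phD.
have rem j : (j <= N)%N ->
    normc (cexp (e j) - 1 - e j) <= 8 * (B / N%:R) ^+ 2.
  move=> jN; rewrite (le_trans (ler_cexp_sub1 _ _))//.
    by rewrite (le_trans (eB _ jN)).
  by rewrite ler_wpM2l// lerXn2r ?nnegrE ?normc_ge0 ?eB// divr_ge0// ltW.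
have Pd : normc (rho_prod (theta N) N - 1) <= A / N%:R.
  rewrite rho_prodE unity_rootXN// mul1r.
  have -> : rho (phase_error N N) - 1 =
    (cexp (e N) - 1 - e N) + e N by rewrite subrK.
  rewrite (le_trans (ler_normcD _ _))// (le_trans (lerD (rem _ _) (eB _ _)))//.
  rewrite /A [leRHS]mulrDl addrC lerD2l -mulrA ler_wpM2l//.
  rewrite expr2 [leRHS]mulrAC ler_wpM2l ?divr_ge0 ?(ltW NR)//.
  by rewrite ler_piMr// invf_le1 ?ler1n.
have Td : normc (rho_prod_sum (theta N) N) <= A / N%:R.
  have -> : rho_prod_sum (theta N) N =
      u * (\sum_(j < N) unity_root N ^+ j * phase_error N j) +
      \sum_(j < N) unity_root N ^+ j * (cexp (e j) - 1 - e j).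
    (* Subtracting this vanishing sum removes the constant term of the exponential. *)
    have w0 : \sum_(j < N) unity_root N ^+ j = 0 :> R[i].
      by apply: sum_powers_eq0; [exact: unity_root_neq1|exact: unity_rootXN].
    rewrite -[LHS]subr0 -[X in _ - X]w0 -sumrB mulr_sumr -big_split /=.
    by apply: eq_bigr => j _; rewrite rho_prodE /rho -/u -/(e j) /e; ring.
  rewrite (le_trans (ler_normcD _ _))// /A [leRHS]mulrDl lerD//.
    by rewrite uE /B -[leRHS]mulrA ler_wpM2l ?mulr_ge0 ?sumD.
  rewrite (le_trans (@ler_normc_sumc _ _ _ (8 * (B / N%:R) ^+ 2) _))//.
    by move=> j; rewrite normcM normc_unity_root mul1r rem// ltnW.
  by rewrite le_eqVlt; apply/orP; left; apply/eqP; field; rewrite gt_eqF.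
have [|w wE wz] := mobius_near_id _ _ _ _ _ Pd Td (Kb _ Kz).
  by rewrite mulrAC ler_pdivrMr//; rewrite /L in LN; lra.
exists w; first by rewrite fcompE.
rewrite normrE_normc ltcR (le_lt_trans wz)//.
rewrite mulrA mulrAC ltr_pdivrMr// -ltr_pdivrMl// mulrC.
have : 2 * A * (b + b ^+ 2) / eps <= 3 * A * (b + b ^+ 2) / eps.
  by rewrite ler_wpM2r ?invr_ge0 ?(ltW eps0)// ler_wpM2r ?addr_ge0 ?exprn_ge0// ler_wpM2r// ler_nat.
rewrite /L in LN; lra.
Qed.

(** Since the powers of the root have modulus 1, [N] terms of size [D / N ^+ 2] already give the
    bound on the linear term, without cancellation. *)
Lemma cvg_id_of_small_phase_error (D : R) :
  (forall N j, (0 < N)%N -> (j <= N)%N ->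
     normc (phase_error N j) <= D / N%:R ^+ 2) ->
  cvg_id_compactly (fun N => fcomp (theta N) N).
Proof.
move=> phD; have D0 : 0 <= D.
  by have := le_trans (normc_ge0 _) (phD 1%N 0%N isT isT); rewrite expr1n divr1.
apply: (@cvg_id_of_phase_error D) => [N j N0 jN|N N2].
  have NR : 1 <= N%:R :> R by rewrite ler1n.
  rewrite (le_trans (phD _ _ N0 jN))// ler_wpM2l// lef_pV2 ?posrE ?exprn_gt0 ?ltr0n//.
  by rewrite expr2 ler_peMr.
have N0 : (0 < N)%N by exact: ltn_trans N2.
rewrite (le_trans (@ler_normc_sumc _ _ _ (D / N%:R ^+ 2) _))//.
  by move=> j; rewrite normcM normc_unity_root mul1r phD// ltnW.
by rewrite le_eqVlt; apply/orP; left; apply/eqP; field; rewrite pnatr_eq0 -lt0n.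
Qed.

(** * Phase errors under each of the three conditions *)

Lemma condition1_cvg_id :
  condition1 theta -> cvg_id_compactly (fun N => fcomp (theta N) N).
Proof.
case=> M thetaM.
have {}thetaM N k : (1 <= k <= N)%N ->
    normc (theta N k - 1 / N%:R) <= M / N%:R ^+ 3.
  move/thetaM; have -> : M%:C * (1 / N%:R ^+ 3) = (M / N%:R ^+ 3)%:C :> R[i].
    by rewrite div1r rmorphM fmorphV rmorphXn rmorph_nat.
  by rewrite normrE_normc lecR.
have M0 : 0 <= M.
  by have := le_trans (normc_ge0 _) (thetaM 1%N 1%N isT); rewrite expr1n divr1.
apply: (@cvg_id_of_small_phase_error M) => N j N0 jN.
have NR : 0 < N%:R :> R by rewrite ltr0n.
rewrite (le_trans (@ler_normc_sumc _ _ _ (M / N%:R ^+ 3) _))//.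
  by move=> k; apply: thetaM; rewrite (leq_trans (ltn_ord k)).
have -> : M / N%:R ^+ 2 = N%:R * (M / N%:R ^+ 3) by field; rewrite gt_eqF.
by rewrite ler_wpM2r ?ler_nat// divr_ge0// exprn_ge0// ltW.
Qed.

Lemma condition2_cvg_id :
  condition2 theta -> cvg_id_compactly (fun N => fcomp (theta N) N).
Proof.
case=> c [thetaE [B cB] [M cM]].
have {}cB N k : (1 <= k <= N)%N -> normc (c N k) <= B.
  by move/cB; rewrite normrE_normc lecR.
have {}cM N k : (1 <= k < N)%N -> odd k ->
    normc (c N k + c N k.+1) <= M / N%:R.
  move=> kN /(cM _ _ kN); rewrite normrE_normc div1r -(rmorph_nat (real_complex R)).
  by rewrite -fmorphV -rmorphM lecR.
have B0 : 0 <= B.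
  exact: le_trans (normc_ge0 _) (cB 1%N 1%N isT).
have M0 : 0 <= M.
  (* The pair bound requires [k < N], so its first instance is at [N = 2]. *)
  have : 0 <= M / 2 := le_trans (normc_ge0 _) (cM 2%N 1%N isT isT); lra.
apply: (@cvg_id_of_small_phase_error (M + B)) => N j N0 jN.
have NR : 0 < N%:R :> R by rewrite ltr0n.
have -> : phase_error N j = (\sum_(k < j) c N k.+1) / N%:R ^+ 2.
  rewrite /phase_error mulr_suml; apply: eq_bigr => k _.
  by rewrite thetaE ?(leq_trans (ltn_ord k))// addrC addKr.
rewrite normcM normcV normcX normc_nat ler_wpM2r ?invr_ge0 ?exprn_ge0 ?(ltW NR)//.
(* The shift by one moves pairs starting at odd [k] to even positions; the bound becomes
   [N * (M / N) + B]. *)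
have pairs := ler_normc_sum_pairs (fun k => c N k.+1) B (M / N%:R) N.
rewrite (le_trans (pairs _ _ _ j jN))//.
- by rewrite divr_ge0// ltW.
- by move=> k kN; apply: cB; rewrite kN.
- by move=> k kN ok; apply: cM.
- rewrite mulrCA divff ?gt_eqF// mulr1 lerD2l.
  by case: (odd j); rewrite ?mul1r ?mul0r.
Qed.

Lemma condition3_cvg_id :
  condition3 theta -> cvg_id_compactly (fun N => fcomp (theta N) N).
Proof.
case=> C thetaE.
have phaseE N j : (0 < N)%N -> (j <= N)%N -> phase_error N j =
    C / N%:R ^+ 2 * \sum_(k < j) unity_root N ^+ k.+1.
  move=> N0 jN; rewrite /phase_error mulr_sumr; apply: eq_bigr => k _.
  rewrite thetaE ?(leq_trans (ltn_ord k))// addrC addKr mulrAC -rhoMn.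
  by rewrite /rho -(mulr_natl (1 / N%:R)) div1r !mulrA.
(* At most [N] unimodular terms weighted by [C / N ^+ 2] give [|C| / N]; the linear sum is exactly
   0. *)
apply: (@cvg_id_of_phase_error (normc C)) => [N j N0 jN|N N2].
  have NR : 0 < N%:R :> R by rewrite ltr0n.
  rewrite phaseE// normcM normcM normcV normcX normc_nat.
  have -> : normc C / N%:R = normc C / N%:R ^+ 2 * N%:R by field; rewrite gt_eqF.
  rewrite ler_wpM2l ?divr_ge0 ?normc_ge0 ?exprn_ge0 ?(ltW NR)//.
  rewrite (le_trans (@ler_normc_sumc _ _ _ 1 _)) ?mulr1 ?ler_nat// => k.
  by rewrite normc_unity_root.
have N0 : (0 < N)%N by exact: ltn_trans N2.
rewrite (eq_bigr (fun j : 'I_N => C / N%:R ^+ 2 *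
    (unity_root N ^+ j * \sum_(k < j) unity_root N ^+ k.+1))) => [|j _].
  rewrite -mulr_sumr sum_powers_partial_sums_eq0 ?unity_root_neq1//.
  - by rewrite mulr0 normc0 divr_ge0 ?normc_ge0.
  - exact: unity_root_sqr_neq1.
  - exact: unity_rootXN.
by rewrite phaseE ?(ltnW (ltn_ord j))// mulrCA.
Qed.

End Perturbation.

Theorem theorem1 (R : realType) (theta : nat -> nat -> R[i])
  (htheta : condition1 theta \/ condition2 theta \/ condition3 theta) :
  cvg_id_compactly (fun N : nat => fcomp (theta N) N).
Proof.
case: htheta => [|[|]].
- exact: condition1_cvg_id.
- exact: condition2_cvg_id.
- exact: condition3_cvg_id.
Qed.
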